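(* Let $q\ge 3$ be an integer, let $\beta\ge 0$, and let $G=(V,E)$ be a finite simple graph on $N$ vertices with maximum degree $\Delta$ and $|E|$ edges. Let $X\in[q]^V$ be distributed according to the Potts model on $G$ with inverse temperature $\beta$ (interaction strength $1/N$), and let $Y\in[q]^V$ be a random configuration where the colour of each vertex is sampled independently and uniformly at random from $[q]$. If $\Delta\tanh(\beta/N)<1$, then for any function $h:[q]^V\to\mathbb{R}$, $$|\mathbb{E}h(X)-\mathbb{E}h(Y)|\le \|L(h)\|_\infty\,\frac{\beta\sqrt{q-1}}{1-\Delta\tanh(\beta/N)}\sqrt{\frac{2|E|}{N}}.$$
   Context: $[q]=\{1,\dots,q\}$. The Potts model on $G=(V,E)$, $|V|=N$, with inverse temperature $\beta$ is the probability measure on $[q]^V$ given by $\mu(\sigma)=e^{-\beta H(\sigma)}/Z(\beta)$, where $$H(\sigma)=-\frac1N\sum_{(u,v)\in V\times V:\ \{u,v\}\in E}\mathbf 1_{\{\sigma(u)=\sigma(v)\}}$$ (the sum is over ordered pairs, so every edge is counted twice) and $Z(\beta)=\sum_\sigma e^{-\beta H(\sigma)}$. Equivalently, given the colours of all vertices other than $v$, the colour of $v$ is $k$ with probability proportional to $\exp\big(\tfrac{2\beta}{N}\#\{u: \{u,v\}\in E,\ \sigma(u)=k\}\big)$. For $h:[q]^V\to\mathbb R$ and $v\in V$, $L_v(h)=\sup|h(\sigma)-h(\tau)|$ over all pairs $\sigma,\tau\in[q]^V$ with $\sigma(u)=\tau(u)$ for all $u\ne v$, and $\|L(h)\|_\infty=\max_{v\in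 V}L_v(h)$. *)

(* Defs.v *)
From HB Require Import structures.
From mathcomp Require Export all_boot all_order all_algebra.
From mathcomp Require Export all_classical all_reals all_analysis.
Export Order.TTheory GRing.Theory Num.Theory.
Export numFieldNormedType.Exports.

Set Implicit Arguments.
Unset Strict Implicit.
Unset Printing Implicit Defensive.

Local Open Scope classical_set_scope.
Local Open Scope ring_scope.

Definition tanh (R : realType) (x : R) : R :=
  (expR x - expR (- x)) / (expR x + expR (- x)).

(** A finite simple graph on [V] is a symmetric irreflexive relation
    [e : rel V]; [e u v] means that [{u, v}] is an edge. *)

Definition edges (V : finType) (e : rel V) : {set {set V}} :=
  [set [set p.1; p.2] | p : V * V & e p.1 p.2]%SET.

Definition degree (V : finType) (e : rel V) (v : V) : nat :=
  #|[set u | e v u]%SET|.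

Definition max_degree (V : finType) (e : rel V) : nat :=
  \max_(v : V) degree e v.

Definition config (V : finType) (q : nat) := {ffun V -> 'I_q}.

(** The sum is over ordered pairs, so each edge contributes twice. *)
Definition hamiltonian (R : realType) (V : finType) (e : rel V) (q : nat)
    (s : config V q) : R :=
  - (#|V|%:R^-1 * \sum_(p : V * V | e p.1 p.2) (s p.1 == s p.2)%:R).

Definition partition_function (R : realType) (V : finType) (e : rel V)
    (q : nat) (beta : R) : R :=
  \sum_(s : config V q) expR (- beta * hamiltonian R e s).

Definition potts (R : realType) (V : finType) (e : rel V) (q : nat)
    (beta : R) (s : config V q) : R :=
  expR (- beta * hamiltonian R e s) / partition_function e q beta.

(** As [V] and ['I_q] are finite, measurability of a random configuration
    amounts to that of the elementary events [{X(v) = k}]. *)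
Definition random_config (d : measure_display) (T : measurableType d)
    (V : finType) (q : nat) (X : T -> config V q) : Prop :=
  forall (v : V) (k : 'I_q), measurable [set t | X t v = k].

Definition potts_distributed (R : realType) (d : measure_display)
    (T : measurableType d) (P : probability T R) (V : finType) (e : rel V)
    (q : nat) (beta : R) (X : T -> config V q) : Prop :=
  random_config X /\
  forall s : config V q, P [set t | X t = s] = (potts e beta s)%:E.

Definition independent_colours (R : realType) (d : measure_display)
    (T : measurableType d) (P : probability T R) (V : finType) (q : nat)
    (Y : T -> config V q) : Prop :=
  forall (A : {set V}) (c : config V q),
    P [set t | forall v, v \in A -> Y t v = c v] =
    (\prod_(v in A) P [set t | Y t v = c v])%E.

Definition uniform_colours (R : realType) (d : measure_display)
    (T : measurableType d) (P : probability T R) (V : finType) (q : nat)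
    (Y : T -> config V q) : Prop :=
  forall (v : V) (k : 'I_q), P [set t | Y t v = k] = (q%:R^-1)%:E.

Definition iid_uniform (R : realType) (d : measure_display)
    (T : measurableType d) (P : probability T R) (V : finType) (q : nat)
    (Y : T -> config V q) : Prop :=
  [/\ random_config Y, independent_colours P Y & uniform_colours P Y].

Definition osc (R : realType) (V : finType) (q : nat)
    (h : config V q -> R) (v : V) : R :=
  sup [set x : R | exists s t : config V q,
    (forall u, u != v -> s u = t u) /\ x = `|h s - h t|].

(** The oscillations are nonnegative, so the base value [0] only matters
    when [V] is empty. *)
Definition osc_norm (R : realType) (V : finType) (q : nat)
    (h : config V q -> R) : R :=
  \big[Num.max/0]_(v : V) osc h v.

(* Main.v *)
(** The Glauber dynamics of the Potts model, which refreshes a uniformly chosen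
    site from its conditional law, preserves the Potts mean.  Changing the colour
    of a neighbour multiplies the conditional weights by factors in
    [[exp (-2b), exp (2b)]], [b = beta / N], hence moves the conditional law by
    at most [tanh b] in total variation; so the dynamics contracts [||L(h)||] by
    [1 - (1 - Delta * tanh b) / N].  Under the uniform measure, one step changes
    the mean of [h] by at most [||L(h)|| / N] times the sum over [v] of the
    expected distance between the conditional law at [v] and the uniform law.
    That distance is at most [b * sum_k |n_k - deg v / q|], where [n_k] counts
    the neighbours of colour [k], and is controlled by the binomial variance and
    the Cauchy-Schwarz inequality.  Iterating the dynamics sums a geometric
    series. *)
Require Import Defs.
From mathcomp Require Import ring lra.

Set Implicit Arguments.
Unset Strict Implicit.
Unset Printing Implicit Defensive.

Local Open Scope ring_scope.

(** * Total variation between weights on a finite set *)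

Section TotalVariation.
Context {R : realType} {I : finType}.
Implicit Types (p w g : I -> R).

(** For families of equal total mass this is half the l1 distance. *)
Definition tv p p' : R := \sum_i Num.max 0 (p i - p' i).

Lemma tv_ge0 p p' : 0 <= tv p p'.
Proof. by apply: sumr_ge0 => i _; rewrite le_max lexx. Qed.

(** With equal masses, [g] may be shifted by its minimum; its values then lie in [[0, L]], so
    dropping the negative parts of [p - p'] only increases the sum. *)
Lemma sum_sub_le_tv p p' g L :
    \sum_i p i = \sum_i p' i -> (forall i j, g i - g j <= L) ->
  \sum_i p i * g i - \sum_i p' i * g i <= tv p p' * L.
Proof.
move=> pp' gL.
have [i0|noI] := pickP I; last by rewrite /tv !big_pred0 // subrr mul0r.
case: (arg_minP g (i0 := i0) (P := predT) isT) => m _ gm.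
have -> : \sum_i p i * g i - \sum_i p' i * g i
    = \sum_i (p i - p' i) * (g i - g m).
  under [RHS]eq_bigr do rewrite mulrBr mulrBl.
  by rewrite sumrB -mulr_suml !sumrB pp' subrr mul0r subr0.
rewrite mulr_suml ler_sum // => i _.
have gim : 0 <= g i - g m by rewrite subr_ge0 gm.
apply: (@le_trans _ _ (Num.max 0 (p i - p' i) * (g i - g m))).
  by rewrite ler_wpM2r // le_max lexx orbT.
by rewrite ler_wpM2l // ?gL // le_max lexx.
Qed.

Lemma abs_sum_sub_le_tv p p' g L :
    \sum_i p i = \sum_i p' i -> (forall i j, g i - g j <= L) ->
  `|\sum_i p i * g i - \sum_i p' i * g i| <= tv p p' * L.
Proof.
move=> pp' gL; rewrite ler_norml sum_sub_le_tv // andbT lerNl.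
have /(sum_sub_le_tv pp') : forall i j, - g i - - g j <= L.
  by move=> i j; rewrite opprK addrC gL.
by under eq_bigr do rewrite mulrN; under [X in _ - X <= _]eq_bigr do
  rewrite mulrN; rewrite !sumrN -opprD.
Qed.

Definition normalize w i : R := w i / \sum_j w j.

Lemma sum_normalize w : \sum_i w i != 0 -> \sum_i normalize w i = 1.
Proof. by move=> w0; rewrite -mulr_suml divff. Qed.

(* Grouping the indices where [normalize w] exceeds [normalize w'] reduces the
   bound to two cells, where it becomes [2 s x y <= x^2 + s^2 y^2]. *)
Lemma tv_normalize_le w w' s :
    1 <= s -> 0 < \sum_i w i -> 0 < \sum_i w' i ->
    (forall i, 0 <= w i) -> (forall i, 0 <= w' i) ->
    (forall i, w i <= s * w' i) -> (forall i, w' i <= s * w i) ->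
  tv (normalize w) (normalize w') <= (s - 1) / (s + 1).
Proof.
move=> s1 W0 W'0 w0 w'0 ww' w'w.
pose A i := normalize w' i < normalize w i.
have -> : tv (normalize w) (normalize w')
    = \sum_(i | A i) (normalize w i - normalize w' i).
  rewrite [RHS]big_mkcond; apply: eq_bigr => i _; rewrite /A maxEle subr_ge0.
  by case: ltgtP => // ->; rewrite subrr.
rewrite sumrB -!mulr_suml.
move: W0 W'0; rewrite !(bigID A xpredT) /=.
set a := \sum_(i | A i) w i; set b := \sum_(i | ~~ A i) w i.
set a' := \sum_(i | A i) w' i; set b' := \sum_(i | ~~ A i) w' i => W0 W'0.
have a_ge0 : 0 <= a by apply: sumr_ge0.
have b_ge0 : 0 <= b by apply: sumr_ge0.
have a'_ge0 : 0 <= a' by apply: sumr_ge0.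
have b'_ge0 : 0 <= b' by apply: sumr_ge0.
have aa' : a <= s * a' by rewrite mulr_sumr ler_sum.
have bb' : b' <= s * b by rewrite mulr_sumr ler_sum.
clearbody a b a' b'.
(* Both sides are affine in [a] and in [b'], so the worst case is
   [a = s a'], [b' = s b]. *)
have key : 2 * a * b' <= 2 * s * (a' * b) + (s - 1) * (a * a' + b * b').
  have s1' : 0 <= s - 1 by rewrite subr_ge0.
  have [h|h] := leP (2 * b') ((s - 1) * a'); first by nra.
  have [k|k] := leP (2 * s * a') ((s - 1) * b).
    by nra.
  (* The gap between the two sides of [key] is the sum of this term, which is its value in the worst
     case, and of the two products below. *)
  have : 0 <= s * (s - 1) * (a' - b) ^+ 2.
    by rewrite mulr_ge0 ?sqr_ge0 // mulr_ge0 //; lra.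
  have : 0 <= (s * a' - a) * (2 * b' - (s - 1) * a').
    by rewrite mulr_ge0 // subr_ge0 // ltW.
  have : 0 <= (s * b - b') * (2 * s * a' - (s - 1) * b).
    by rewrite mulr_ge0 // subr_ge0 // ltW.
  nra.
have -> : a / (a + b) - a' / (a' + b')
    = (a * b' - b * a') / ((a + b) * (a' + b')).
  by field; rewrite !gt_eqF.
rewrite ler_pdivrMr ?mulr_gt0 // mulrAC ler_pdivlMr; last lra.
nra.
Qed.

(* Centre the exponents to [th] with sum [0].  The denominator [S] is then at
   least [q], and [1 - th i <= expR (- th i)] gives
   [expR (th i) / S - 1 / q <= expR (th i) / S * th i]. *)
Lemma tv_softmax_uniform_le (c : R) (n : I -> R) : (0 < #|I|)%N -> 0 <= c ->
  tv (normalize (fun i => expR (c * n i))) (fun=> #|I|%:R^-1)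
    <= c / 2 * \sum_i `|n i - (\sum_j n j) / #|I|%:R|.
Proof.
move=> I0 c0; set m := _ / #|I|%:R; pose q : R := #|I|%:R.
have q0 : 0 < q by rewrite ltr0n.
pose th i := c * (n i - m).
pose S := \sum_i expR (th i).
have sum_th : \sum_i th i = 0.
  rewrite -mulr_sumr sumrB sumr_const -[X in _ - X]mulr_natr divfK ?gt_eqF //.
  by rewrite subrr mulr0.
have S_ge : q <= S.
  rewrite -[q]addr0 -sum_th.
  have -> : q + \sum_i th i = \sum_i (1 + th i).
    by rewrite big_split /= sumr_const.
  by apply: ler_sum => i _; exact: expR_ge1Dx.
have S0 : 0 < S by apply: lt_le_trans S_ge.
have shift i : normalize (fun i => expR (c * n i)) i = expR (th i) / S.
  have E j : expR (c * n j) = expR (c * m) * expR (th j).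
    by rewrite -expRD /th; congr expR; ring.
  rewrite /normalize E; under eq_bigr do rewrite E.
  rewrite -mulr_sumr -/S; field.
  by rewrite !gt_eqF ?expR_gt0.
have pos i : expR (th i) / S - q^-1 <= Num.max 0 (th i).
  have e1 : expR (th i) * (1 - th i) <= 1.
    rewrite -[leRHS](expRxMexpNx_1 (th i)) ler_wpM2l ?expR_ge0 //.
    exact: expR_ge1Dx.
  have qS : S^-1 <= q^-1 by rewrite lef_pV2.
  have : expR (th i) / S * (1 - th i) <= q^-1.
    by apply: le_trans qS; rewrite mulrAC ler_piMl // invr_ge0 ltW.
  have p1 : expR (th i) / S <= 1.
    rewrite ler_pdivrMr // mul1r /S (bigD1 i) //= lerDl.
    by apply: sumr_ge0 => j _; exact: expR_ge0.
  have p0 : 0 <= expR (th i) / S by rewrite divr_ge0 ?expR_ge0 // ltW.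
  move: p0 p1; set p := _ / S => p0 p1 h.
  rewrite le_max; have [t0|t0] := leP (th i) 0.
    by apply/orP; left; nra.
  by apply/orP; right; nra.
(* As the [th i] sum to [0], their positive parts sum to half the sum of the [|th i|]; hence the
   factor [c / 2]. *)
have half i : Num.max 0 (th i) = (th i + c * `|n i - m|) / 2.
  have -> : c * `|n i - m| = `|th i| by rewrite normrM (ger0_norm c0).
  have [t|t] := leP 0 (th i); first by rewrite ger0_norm //; lra.
  by rewrite ltr0_norm //; lra.
apply: le_trans (_ : \sum_i Num.max 0 (th i) <= _).
  by apply: ler_sum => i _; rewrite shift ge_max le_max lexx pos.
under eq_bigr do rewrite half.
by rewrite -mulr_suml big_split /= sum_th add0r -mulr_sumr mulrAC.
Qed.
End TotalVariation.

(** * Single-site recolouring and Lipschitz functions of a configuration *)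

Section Recolouring.
Context {R : realType} {V : finType} {q : nat}.
Implicit Types (s t : config V q) (v u : V) (k : 'I_q) (g : config V q -> R).

Definition recolour s v k : config V q := [ffun u => if u == v then k else s u].

Lemma recolour_same s v k : recolour s v k v = k.
Proof. by rewrite ffunE eqxx. Qed.

Lemma recolour_other s v k u : u != v -> recolour s v k u = s u.
Proof. by move=> uv; rewrite ffunE (negPf uv). Qed.

Lemma recolourK s v k j : recolour (recolour s v k) v j = recolour s v j.
Proof. by apply/ffunP => u; rewrite !ffunE; case: eqP. Qed.

Lemma recolour_id s v : recolour s v (s v) = s.
Proof. by apply/ffunP => u; rewrite ffunE; case: eqP => [->|]. Qed.

Definition agree_off v s t := forall u, u != v -> s u = t u.

Lemma recolour_agree_off v s t k :
  agree_off v s t -> recolour s v k = recolour t v k.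
Proof. by move=> st; apply/ffunP => u; rewrite !ffunE; case: eqVneq => // /st. Qed.

Lemma agree_off_recolour u v s t k :
  agree_off u s t -> agree_off u (recolour s v k) (recolour t v k).
Proof. by move=> st w wu; rewrite !ffunE; case: eqP => // _; exact: st. Qed.

(** Exchanging the colour at [v] with the auxiliary colour [k] is an involution of the pairs
    [(s, k)], so uniform resampling at [v] preserves the counting measure. *)
Lemma sum_recolour v g :
  \sum_s \sum_k g (recolour s v k) = q%:R * \sum_s g s.
Proof.
pose f (x : config V q * 'I_q) := (recolour x.1 v x.2, x.1 v).
have fK : involutive f.
  by case=> s k; rewrite /f /= recolourK recolour_id recolour_same.
rewrite pair_big /= (reindex_inj (inv_inj fK)) /=.
under eq_bigr do rewrite recolourK recolour_id.
rewrite -(pair_big xpredT xpredT (fun s _ => g s)) /= mulr_sumr.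
by apply: eq_bigr => s _; rewrite sumr_const card_ord mulr_natl.
Qed.

Definition lipschitz g (L : R) :=
  forall v s t, agree_off v s t -> `|g s - g t| <= L.

(** Pass from [s] to [t] one site at a time; [mix r] has already switched on [r]. *)
Lemma lipschitz_dist g L s t : lipschitz g L -> `|g s - g t| <= #|V|%:R * L.
Proof.
move=> gL; pose mix (r : seq V) : config V q :=
  [ffun u => if u \in r then t u else s u].
have mixL r : `|g s - g (mix r)| <= (size r)%:R * L.
  elim: r => [|v r IH].
    rewrite (_ : mix [::] = s) ?subrr ?normr0 ?mul0r //.
    by apply/ffunP => u; rewrite ffunE.
  rewrite (le_trans (ler_distD (g (mix r)) _ _)) //= -natr1 mulrDl mul1r.
  rewrite lerD // (gL v) // => u uv.
  by rewrite !ffunE inE (negPf uv).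
have := mixL (enum V); rewrite -cardE (_ : mix _ = t) //.
by apply/ffunP => u; rewrite ffunE mem_enum.
Qed.

Lemma osc_norm_lipschitz g : lipschitz g (osc_norm g).
Proof.
move=> v s t st; apply: (@le_trans _ _ (osc g v)); last first.
  by rewrite /osc_norm (bigD1 v) //= le_max lexx.
apply: ub_le_sup; last by exists s, t.
(* A crude upper bound of the set, so that [sup] is a genuine supremum. *)
exists (\sum_a \sum_b `|g a - g b|) => x [a [b [_ ->]]].
rewrite (bigD1 a) //= (bigD1 b) //= -addrA lerDl addr_ge0 //.
  exact: sumr_ge0.
by apply: sumr_ge0 => c _; exact: sumr_ge0.
Qed.

End Recolouring.

(** * Glauber dynamics for an arbitrary positive weight *)

Section Glauber.
Context {R : realType} {V : finType} {q : nat}.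
Variable w : config V q -> R.
Hypothesis w_gt0 : forall s, 0 < w s.
Hypothesis q_gt0 : (0 < q)%N.
Hypothesis V_gt0 : (0 < #|V|)%N.
Implicit Types (s t : config V q) (v u : V) (k : 'I_q) (g : config V q -> R).

Let N : R := #|V|%:R.
Let N_gt0 : 0 < N. Proof. by rewrite ltr0n. Qed.

Definition gibbs_mean g := (\sum_s w s * g s) / \sum_s w s.

Definition unif_mean g := (\sum_s g s) / #|config V q|%:R.

(** The conditional law of the colour at [v] given the other colours, under the measure proportional
    to [w]; the value [s v] has no effect. *)
Definition local_law v s : 'I_q -> R := normalize (fun k => w (recolour s v k)).

Definition update v g s := \sum_k local_law v s k * g (recolour s v k).

Definition glauber g s := (\sum_v update v g s) / #|V|%:R.

Definition unif_dist v :=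
  unif_mean (fun s => tv (local_law v s) (fun=> q%:R^-1)).

Let card_gt0 : 0 < #|config V q|%:R :> R.
Proof. by rewrite ltr0n card_ffun card_ord expn_gt0 q_gt0. Qed.

Lemma local_mass_gt0 v s : 0 < \sum_k w (recolour s v k).
Proof.
rewrite (bigD1 (Ordinal q_gt0)) //= ltr_pwDl // sumr_ge0 // => k _.
exact: ltW.
Qed.

Lemma sum_local_law v s : \sum_k local_law v s k = 1.
Proof. by rewrite sum_normalize // gt_eqF // local_mass_gt0. Qed.

Lemma local_law_ge0 v s k : 0 <= local_law v s k.
Proof. by rewrite divr_ge0 ?ltW // local_mass_gt0. Qed.

Lemma partition_gt0 : 0 < \sum_s w s.
Proof.
rewrite (bigD1 [ffun=> Ordinal q_gt0]) //= ltr_pwDl // sumr_ge0 // => k _.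
exact: ltW.
Qed.

(** On each class of configurations agreeing off [v], [update v g] is constant, equal to the
    [w]-weighted mean of [g] over the class. [sum_recolour] reduces the claim to these classes. *)
Lemma gibbs_mean_update v g : gibbs_mean (update v g) = gibbs_mean g.
Proof.
have q0 : q%:R != 0 :> R by rewrite pnatr_eq0 -lt0n.
rewrite /gibbs_mean; congr (_ / _); apply: (mulfI q0).
rewrite -!(sum_recolour v); apply: eq_bigr => s _.
transitivity (\sum_k w (recolour s v k) * update v g s).
  apply: eq_bigr => k _; congr (_ * _); apply: eq_bigr => j _.
  rewrite recolourK; congr (_ * _).
  by rewrite /local_law /normalize; under eq_bigr do rewrite recolourK;
    rewrite recolourK.
rewrite -mulr_suml mulr_sumr; apply: eq_bigr => k _.
rewrite /local_law /normalize mulrA; congr (_ * _); field.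
by rewrite gt_eqF // local_mass_gt0.
Qed.

Lemma gibbs_mean_glauber g : gibbs_mean (glauber g) = gibbs_mean g.
Proof.
have -> : gibbs_mean (glauber g) = (\sum_v gibbs_mean (update v g)) / N.
  rewrite /gibbs_mean -mulr_suml mulrAC; congr (_ / _).
  rewrite exchange_big /= mulr_suml; apply: eq_bigr => s _.
  by rewrite mulrA mulr_sumr.
under eq_bigr do rewrite gibbs_mean_update.
by rewrite sumr_const -mulr_natr mulfK ?gt_eqF.
Qed.

(** The uniform mean is also the mean after a uniform resampling at [v], so it remains to compare
    two resampling laws at one site, along which [g] varies by at most [L]. *)
Lemma unif_mean_update_dist v g L : lipschitz g L ->
  `|unif_mean g - unif_mean (update v g)| <= unif_dist v * L.
Proof.
move=> gL.
have q0 : q%:R != 0 :> R by rewrite pnatr_eq0 -lt0n.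
rewrite /unif_dist /unif_mean -mulrBl normrM mulrAC.
rewrite [X in _ * X]ger0_norm ?ler_wpM2r ?invr_ge0 //.
have -> : \sum_s g s = \sum_s \sum_k q%:R^-1 * g (recolour s v k).
  under [RHS]eq_bigr do rewrite -mulr_sumr.
  by rewrite -mulr_sumr sum_recolour mulKf.
rewrite -sumrB (le_trans (ler_norm_sum _ _ _)) // mulr_suml.
apply: ler_sum => s _; rewrite distrC abs_sum_sub_le_tv //.
  by rewrite sum_local_law sumr_const card_ord -(mulr_natr q%:R^-1) mulVf.
move=> i j; rewrite (le_trans (ler_norm _)) // (gL v) // => u uv.
by rewrite !recolour_other.
Qed.

Lemma unif_mean_glauber_dist g L : lipschitz g L ->
  `|unif_mean g - unif_mean (glauber g)| <= (\sum_v unif_dist v) * L / N.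
Proof.
move=> gL.
have -> : unif_mean g - unif_mean (glauber g)
    = (\sum_v (unif_mean g - unif_mean (update v g))) / N.
  rewrite sumrB sumr_const -[_ *+ #|_|]mulr_natr mulrBl mulfK ?gt_eqF //.
  congr (_ - _); rewrite /unif_mean -!mulr_suml mulrAC; congr (_ / _ / _).
  by rewrite exchange_big.
rewrite normrM [X in _ * X]ger0_norm ?invr_ge0 ?(ltW N_gt0) //.
rewrite ler_wpM2r ?invr_ge0 ?(ltW N_gt0) // mulr_suml.
by rewrite (le_trans (ler_norm_sum _ _ _)) // ler_sum // => v _;
  exact: unif_mean_update_dist.
Qed.

(** * Contraction under a Dobrushin influence matrix [c], and its iteration *)

Section Contraction.
Variables (c : V -> V -> R) (a : R).
Hypothesis influence : forall u v s t, u != v -> agree_off u s t ->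
  tv (local_law v s) (local_law v t) <= c u v.
Hypothesis c_ge0 : forall u v, 0 <= c u v.
Hypothesis sum_c : forall u, \sum_v c u v <= a.

Let rho : R := 1 - (1 - a) / N.

(** A difference at [u] is erased when [v = u]. Otherwise it persists at cost [L], and the shift of
    the conditional law at [v] costs a further [c u v * L]. *)
Lemma update_dist u v g L s t : 0 <= L -> lipschitz g L -> agree_off u s t ->
  `|update v g s - update v g t| <= (u != v)%:R * L + c u v * L.
Proof.
move=> L0 gL st; case: eqVneq => [uv|uv] /=.
  rewrite (_ : update v g s = update v g t) ?subrr ?normr0.
    by rewrite mul0r add0r mulr_ge0.
  rewrite /update /local_law /normalize -uv.
  apply: eq_bigr => k _; under eq_bigr do rewrite (recolour_agree_off _ st).
  by rewrite (recolour_agree_off _ st).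
rewrite mul1r (le_trans (ler_distD
  (\sum_k local_law v s k * g (recolour t v k)) _ _)) // lerD //.
  rewrite -sumrB (le_trans (ler_norm_sum _ _ _)) //.
  rewrite -[leRHS]mul1r -(sum_local_law v s) mulr_suml ler_sum // => k _.
  rewrite -mulrBr normrM ger0_norm ?local_law_ge0 //.
  rewrite ler_wpM2l ?local_law_ge0 // (gL u) //.
  exact: agree_off_recolour.
apply: le_trans (_ : tv (local_law v s) (local_law v t) * L <= _).
  apply: abs_sum_sub_le_tv; first by rewrite !sum_local_law.
  move=> i j; rewrite (le_trans (ler_norm _)) // (gL v) // => x xv.
  by rewrite !recolour_other.
by rewrite ler_wpM2r // (influence uv).
Qed.

(** The [N - 1] sites other than [u] contribute [L] each and the influences at most [a * L] in
    total; dividing by [N] gives the factor [rho]. *)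
Lemma glauber_lipschitz g L : 0 <= L -> lipschitz g L ->
  lipschitz (glauber g) (rho * L).
Proof.
move=> L0 gL u s t st.
rewrite /glauber -mulrBl -sumrB normrM -/N.
rewrite [X in _ * X]ger0_norm ?invr_ge0 ?(ltW N_gt0) // ler_pdivrMr //.
apply: le_trans (ler_norm_sum _ _ _) _.
apply: le_trans (_ : \sum_v ((u != v)%:R * L + c u v * L) <= _).
  by apply: ler_sum => v _; exact: update_dist.
rewrite big_split /= -!mulr_suml -mulrDl.
have -> : rho * L * N = (N - 1 + a) * L by rewrite /rho; field; rewrite gt_eqF.
rewrite ler_wpM2r // lerD //.
have -> : N - 1 = \sum_(v | v != u) 1.
  by rewrite /N -sum1_card natr_sum (bigD1 u) //= addrAC subrr add0r.
rewrite (bigD1 u) //= eqxx add0r.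
by apply: ler_sum => v _; case: (u == v).
Qed.

Lemma lipschitz_ge0 g L : lipschitz g L -> 0 <= L.
Proof.
move=> gL; case/card_gt0P: V_gt0 => v _.
pose s : config V q := [ffun=> Ordinal q_gt0].
by have := gL v s s (fun _ _ => erefl); rewrite subrr normr0.
Qed.

(** Both means are averages, so their difference averages [g s - g t] over pairs. This starts the
    iteration and also covers empty [V]. *)
Lemma gibbs_unif_dist_crude g L : lipschitz g L ->
  `|gibbs_mean g - unif_mean g| <= N * L.
Proof.
move=> gL; have Z0 := partition_gt0.
have E : gibbs_mean g - unif_mean g =
  (\sum_s \sum_t w s * (g s - g t)) / (#|config V q|%:R * \sum_s w s).
  have -> : \sum_s \sum_t w s * (g s - g t) =
    #|config V q|%:R * (\sum_s w s * g s) - (\sum_s w s) * \sum_s g s.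
    rewrite mulr_sumr mulr_suml -sumrB; apply: eq_bigr => s _.
    rewrite -mulr_sumr sumrB sumr_const -[g s *+ #|_|]mulr_natr; ring.
  rewrite /gibbs_mean /unif_mean; field.
  by rewrite !gt_eqF.
rewrite E normrM normfV [X in _ / X]gtr0_norm ?mulr_gt0 //.
rewrite ler_pdivrMr ?mulr_gt0 //.
apply: le_trans (ler_norm_sum _ _ _) _.
have -> : N * L * (#|config V q|%:R * \sum_s w s)
    = \sum_s \sum_(t : config V q) w s * (N * L).
  under [RHS]eq_bigr do rewrite sumr_const -mulr_natr.
  rewrite -!mulr_suml; ring.
apply: ler_sum => s _; apply: le_trans (ler_norm_sum _ _ _) _.
apply: ler_sum => t _; rewrite normrM gtr0_norm // ler_pM2l //.
exact: lipschitz_dist.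
Qed.

Hypothesis a_lt1 : a < 1.

Let D := (\sum_v unif_dist v) / (1 - a).

(* Replacing [g] by [glauber g] leaves the Gibbs mean unchanged, moves the
   uniform mean by at most [(1 - rho) D L] and shrinks [L] by [rho]. *)
Lemma gibbs_unif_dist_iter n g L : lipschitz g L ->
  `|gibbs_mean g - unif_mean g| <= (N * rho ^+ n + D) * L.
Proof.
have D0 : 0 <= D.
  rewrite divr_ge0 //; last by rewrite subr_ge0 ltW.
  apply: sumr_ge0 => v _.
  by rewrite divr_ge0 ?sumr_ge0 // => s _; exact: tv_ge0.
elim: n g L => [|n IH] g L gL; have L0 := lipschitz_ge0 gL.
  rewrite expr0 mulr1 (le_trans (gibbs_unif_dist_crude gL)) //.
  by rewrite ler_wpM2r // lerDl.
rewrite -gibbs_mean_glauber.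
apply: le_trans (ler_distD (unif_mean (glauber g)) _ _) _.
apply: le_trans (lerD (IH _ _ (glauber_lipschitz L0 gL)) _) _.
  by rewrite distrC; exact: (unif_mean_glauber_dist gL).
rewrite exprSr le_eqVlt; apply/orP; left; apply/eqP.
set X := rho ^+ n; rewrite /D /rho; field.
by rewrite subr_eq0 !gt_eqF.
Qed.

Lemma gibbs_unif_dist g L : lipschitz g L ->
  `|gibbs_mean g - unif_mean g| <= D * L.
Proof.
move=> gL; have L0 := lipschitz_ge0 gL.
have a0 : 0 <= a.
  case/card_gt0P: V_gt0 => u _; apply: le_trans (sum_c u).
  exact: sumr_ge0.
have N1 : 1 <= N by rewrite ler1n.
(* From [0 <= a < 1 <= N], [rho] lies in [[0, 1)], so the term [N * rho ^+ n] of the iterated bound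
   vanishes in the limit. *)
have rho_lt1 : `|rho| < 1.
  have x1 : 0 < (1 - a) / N by rewrite divr_gt0 // subr_gt0.
  have x2 : (1 - a) / N <= 1 by rewrite ler_pdivrMr // mul1r; lra.
  by rewrite /rho ger0_norm; lra.
have lim : ((fun n => (N * rho ^+ n + D) * L) @ \oo --> (0 + D) * L)%classic.
  apply: cvgMl; apply: cvgD; last exact: cvg_cst.
  exact: cvg_geometric.
rewrite -[D]add0r -(cvg_lim _ lim) //; apply: limr_ge; first exact: cvgP lim.
by near=> n; exact: gibbs_unif_dist_iter.
Unshelve. all: by end_near.
Qed.

End Contraction.
End Glauber.

(** * Hyperbolic tangent, the Cauchy-Schwarz inequality and the degree sum *)

Lemma tanhE (R : realType) (x : R) : tanh x = (expR (2 * x) - 1) / (expR (2 * x) + 1).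
Proof.
have x0 := expR_gt0 x.
rewrite /tanh expRN mulr_natl mulr2n expRD; field.
by rewrite !gt_eqF ?addr_gt0 ?mulr_gt0 ?ltr01.
Qed.

Lemma tanh_ge0 (R : realType) (x : R) : 0 <= x -> 0 <= tanh x.
Proof.
move=> x0; rewrite /tanh divr_ge0 //.
by rewrite subr_ge0 ler_expR; lra.
Qed.

(** Cauchy-Schwarz against the constant [1], from the nonnegativity of the double sum of
    [(|x i| - |x j|)^2]. *)
Lemma sum_norm_le_sqrt (R : realType) (I : finType) (x : I -> R) :
  \sum_i `|x i| <= Num.sqrt (#|I|%:R * \sum_i x i ^+ 2).
Proof.
rewrite -[leLHS]ger0_norm ?sumr_ge0 // -sqrtr_sqr ler_wsqrtr //.
have : 0 <= \sum_i \sum_j (`|x i| - `|x j|) ^+ 2.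
  by apply: sumr_ge0 => i _; apply: sumr_ge0 => j _; exact: sqr_ge0.
pose A : R := \sum_i `|x i|; pose B : R := \sum_i x i ^+ 2.
rewrite -/A -/B.
have -> : \sum_i \sum_j (`|x i| - `|x j|) ^+ 2 = 2 * (#|I|%:R * B - A ^+ 2).
  have inner i : \sum_j (`|x i| - `|x j|) ^+ 2
      = #|I|%:R * x i ^+ 2 + B - 2 * A * `|x i|.
    have E j : (`|x i| - `|x j|) ^+ 2 = x i ^+ 2 + x j ^+ 2 - 2 * `|x i| * `|x j|.
      by rewrite sqrrB !real_normK ?num_real //; ring.
    under eq_bigr do rewrite E.
    rewrite sumrB big_split /= sumr_const -mulr_sumr -/A -/B.
    by rewrite -(mulr_natr (x i ^+ 2)); ring.
  under eq_bigr do rewrite inner.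
  rewrite sumrB big_split /= -!mulr_sumr sumr_const -/A -/B.
  by rewrite -(mulr_natr B); ring.
by rewrite pmulr_rge0 // subr_ge0.
Qed.

(** The degrees count ordered adjacent pairs, and each [{a, b}] comes from at most the two pairs
    [(a, b)] and [(b, a)]. *)
Lemma sum_degree_le (V : finType) (e : rel V) :
  (\sum_v degree e v <= 2 * #|edges e|)%N.
Proof.
pose E := [set p : V * V | e p.1 p.2]%SET.
have -> : (\sum_v degree e v = #|E|)%N.
  rewrite -sum1dep_card -(pair_big_dep xpredT (fun u v => e u v) (fun _ _ => 1%N)).
  by apply: eq_bigr => v _; rewrite /degree -sum1dep_card.
pose f (p : V * V) := [set p.1; p.2]%SET.
have -> : edges e = [set f p | p in E]%SET.
  by apply/setP => A; apply/imsetP/imsetP => -[p pE ->]; exists p => //;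
    move: pE; rewrite !inE.
rewrite -sum1_card (partition_big_imset f) /= mulnC -sum_nat_const.
apply: leq_sum => A /imsetP[p0 _ ->]; rewrite sum1dep_card.
apply: (@leq_trans #|[set p0; (p0.2, p0.1)]%SET|); last by rewrite cards2; case: eqP.
apply/subset_leq_card/fintype.subsetP => -[a b]; rewrite !inE /f /= => /andP[_ /eqP fp].
case: p0 fp => c d /= fp; rewrite !xpair_eqE.
have : a \in [set c; d]%SET by rewrite -fp !inE eqxx.
have : b \in [set c; d]%SET by rewrite -fp !inE eqxx orbT.
have : c \in [set a; b]%SET by rewrite fp !inE eqxx.
have : d \in [set a; b]%SET by rewrite fp !inE eqxx orbT.
by rewrite !inE ![c == _]eq_sym ![d == _]eq_sym;
  do 4![case: eqP => //= ?]; subst; rewrite ?eqxx.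
Qed.

(** * The Potts model: local laws, influences and distance to uniform *)

Section Potts.
Context {R : realType} {V : finType} {q : nat}.
Variables (e : rel V) (beta : R).
Hypotheses (e_sym : symmetric e) (e_irr : irreflexive e) (beta_ge0 : 0 <= beta).
Hypothesis q_gt0 : (0 < q)%N.
Implicit Types (s t : config V q) (v u : V) (k : 'I_q).

Let b : R := beta / #|V|%:R.
Let b_ge0 : 0 <= b. Proof. by rewrite divr_ge0. Qed.
Let q_neq0 : q%:R != 0 :> R. Proof. by rewrite pnatr_eq0 -lt0n. Qed.

Definition potts_weight s : R := expR (- beta * hamiltonian R e s).

Definition neighbours v s k : R := \sum_(u | e v u) (s u == k)%:R.

(** Each edge at [v] occurs in two ordered pairs, whence [2 * b]. The second factor does not depend
    on [k], so it cancels in [local_law]. *)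
Lemma potts_weight_recolour v s k : potts_weight (recolour s v k) =
  expR (2 * b * neighbours v s k) *
  expR (b * \sum_(u | u != v) \sum_(u' | e u u' && (u' != v)) (s u == s u')%:R).
Proof.
rewrite /potts_weight -expRD; congr expR; set t := recolour s v k.
have -> : - beta * hamiltonian R e t
    = b * \sum_u \sum_(u' | e u u') (t u == t u')%:R.
  by rewrite /hamiltonian mulrNN mulrA /b pair_big_dep.
rewrite (mulrC 2 b) -(mulrA b 2) -(mulrDr b); congr (_ * _).
have star : \sum_(u | e v u) (t v == t u)%:R = neighbours v s k.
  apply: eq_bigr => u vu; rewrite recolour_same recolour_other 1?eq_sym //.
  by apply: contraTneq vu => ->; rewrite e_irr.
rewrite (bigD1 v) //= star mulr_natl mulr2n -addrA; congr (_ + _).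
(* The terms with [u' = v] form the second copy of [neighbours v s k]. *)
under eq_bigr => u uv do rewrite (bigID (pred1 v)) /= big_mkcondl /= big_pred1_eq.
rewrite big_split /= -big_mkcondr; congr (_ + _).
  rewrite -star; apply: eq_big => [u|u _]; last by rewrite eq_sym.
  by rewrite e_sym andbC; case: eqVneq => [->|]; rewrite ?e_irr ?andbT.
apply: eq_bigr => u uv; apply: eq_bigr => u' /andP[_ u'v].
by rewrite !recolour_other.
Qed.

Lemma local_law_potts v s : local_law potts_weight v s
  =1 normalize (fun k => expR (2 * b * neighbours v s k)).
Proof.
move=> k; rewrite /local_law /normalize.
under eq_bigr do rewrite potts_weight_recolour.
rewrite potts_weight_recolour.
by rewrite -mulr_suml -mulf_div divff ?mulr1 // gt_eqF ?expR_gt0.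
Qed.

Lemma neighbours_diff u v s t k : agree_off u s t ->
  neighbours v s k <= neighbours v t k + (e v u)%:R.
Proof.
move=> st; rewrite /neighbours; case: (boolP (e v u)) => vu.
  rewrite !(bigD1 u vu) /= addrC [X in _ <= X + _]addrC -addrA lerD //.
    rewrite ler_sum // => x /andP[_ xu]; by rewrite st.
  by case: (s u == k); rewrite ?lerDr ?addr_ge0.
rewrite addr0 ler_sum // => x vx; rewrite st //.
by apply: contraTneq vx => ->.
Qed.

Lemma sum_exp_gt0 (f : 'I_q -> R) : 0 < \sum_k expR (f k).
Proof.
by rewrite (bigD1 (Ordinal q_gt0)) //= ltr_pwDl ?expR_gt0 // sumr_ge0.
Qed.

(** Changing the colour at [u] alters each local weight at [v] by a factor of at most [expR (2 * b)]
    if [u] and [v] are adjacent, and not at all otherwise. With [s = expR (2 * b)] the bound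
    [(s - 1) / (s + 1)] of [tv_normalize_le] is [tanh b]. *)
Lemma potts_influence u v s t : agree_off u s t ->
  tv (local_law potts_weight v s) (local_law potts_weight v t)
    <= (e u v)%:R * tanh b.
Proof.
move=> st; have ts : agree_off u t s by move=> x xu; rewrite st.
have -> : tv (local_law potts_weight v s) (local_law potts_weight v t)
  = tv (normalize (fun k => expR (2 * b * neighbours v s k)))
       (normalize (fun k => expR (2 * b * neighbours v t k))).
  by apply: eq_bigr => k _; rewrite !local_law_potts.
have step s' t' k : agree_off u s' t' ->
    expR (2 * b * neighbours v s' k)
    <= expR (2 * b * (e v u)%:R) * expR (2 * b * neighbours v t' k).
  move=> st'; rewrite -expRD ler_expR -mulrDr ler_wpM2l ?mulr_ge0 // addrC.
  exact: neighbours_diff.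
have := tv_normalize_le (s := expR (2 * b * (e v u)%:R)) _ (sum_exp_gt0 _)
  (sum_exp_gt0 _) (fun k => expR_ge0 _) (fun k => expR_ge0 _)
  (fun k => step s t k st) (fun k => step t s k ts).
rewrite (e_sym u v); case: (e v u); rewrite /= ?mulr1 ?mulr0 ?mul1r ?mul0r.
  by rewrite tanhE; apply; rewrite -expR0 ler_expR mulr_ge0.
by rewrite expR0 subrr mul0r; apply.
Qed.

Lemma sum_neighbours v s : \sum_k neighbours v s k = (degree e v)%:R.
Proof.
rewrite exchange_big /= /degree -sum1dep_card natr_sum; apply: eq_bigr => u _.
rewrite (bigD1 (s u)) //= eqxx big1 ?addr0 // => k.
by rewrite eq_sym => /negPf ->.
Qed.

Let xi u k s : R := (s u == k)%:R - q%:R^-1.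

Let sum_xi (k : 'I_q) : \sum_j ((j == k)%:R - q%:R^-1) = 0 :> R.
Proof.
rewrite sumrB (bigD1 k) //= eqxx big1 => [|j /negPf -> //].
by rewrite sumr_const card_ord -(mulr_natr q%:R^-1) mulVf // addr0 subrr.
Qed.

(** Resampling at [u] averages the factor at [u] to [0] when [u' != u]: under the uniform law the
    centred indicators at distinct sites are uncorrelated, and each has variance
    [(q - 1) / q ^ 2]. *)
Let sum_xi_mul u u' k : \sum_s xi u k s * xi u' k s
  = (u == u')%:R * (#|config V q|%:R * ((q%:R - 1) / q%:R ^+ 2)).
Proof.
apply: (mulfI q_neq0); rewrite -(sum_recolour u).
have -> : \sum_s \sum_j xi u k (recolour s u j) * xi u' k (recolour s u j) =
    \sum_(s : config V q) (u == u')%:R * (1 - q%:R^-1).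
  apply: eq_bigr => s _; case: eqVneq => [<-|uu'] /=; last first.
    rewrite mul0r; transitivity ((\sum_j ((j == k)%:R - q%:R^-1)) * xi u' k s).
      rewrite mulr_suml.
      by apply: eq_bigr => j _; rewrite /xi recolour_same recolour_other // eq_sym.
    by rewrite sum_xi mul0r.
  transitivity (\sum_j (((j == k)%:R - q%:R^-1) * (j == k)%:R
    - ((j == k)%:R - q%:R^-1) * q%:R^-1) : R).
    by apply: eq_bigr => j _; rewrite /xi recolour_same -mulrBr.
  rewrite sumrB -[X in _ - X]mulr_suml sum_xi mul0r subr0 mul1r.
  rewrite (bigD1 k) //= eqxx mulr1 big1 ?addr0 // => j /negPf ->.
  by rewrite mulr0.
rewrite sumr_const -mulr_natr; field.
exact: q_neq0.
Qed.

(** The binomial variance: the deviation is the sum of [xi u k] over the neighbours [u] of [v], and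
    the cross terms vanish. *)
Let sum_sqr_neighbours v k :
  \sum_s (neighbours v s k - (degree e v)%:R / q%:R) ^+ 2
    = (degree e v)%:R * (#|config V q|%:R * ((q%:R - 1) / q%:R ^+ 2)).
Proof.
have dev s : neighbours v s k - (degree e v)%:R / q%:R = \sum_(u | e v u) xi u k s.
  rewrite sumrB; congr (_ - _).
  rewrite /degree -sum1dep_card natr_sum mulr_suml.
  by apply: eq_bigr => u _; rewrite mul1r.
under eq_bigr => s _.
  rewrite dev expr2 mulr_suml; under eq_bigr do rewrite mulr_sumr.
  over.
rewrite exchange_big /= /degree -sum1dep_card natr_sum mulr_suml.
apply: eq_bigr => u vu; rewrite exchange_big /= (bigD1 u) //= sum_xi_mul eqxx.
rewrite big1 ?addr0 // => u' /andP[_ u'u].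
by rewrite sum_xi_mul eq_sym (negPf u'u) mul0r.
Qed.

(** One Cauchy-Schwarz over all [N * M * q] triples [(v, s, k)] brings in only the sum of the
    degrees, and its [q] cancels the denominator left by the variance. *)
Lemma sum_unif_dist_potts : \sum_v unif_dist potts_weight v
  <= beta * Num.sqrt (q.-1)%:R * Num.sqrt (2 * #|edges e|%:R / #|V|%:R).
Proof.
pose M : R := #|config V q|%:R; pose N : R := #|V|%:R.
have M_gt0 : 0 < M by rewrite ltr0n card_ffun card_ord expn_gt0 q_gt0.
pose dev (x : V * (config V q * 'I_q)) : R :=
  neighbours x.1 x.2.1 x.2.2 - (degree e x.1)%:R / q%:R.
have tv_le v s : tv (local_law potts_weight v s) (fun=> q%:R^-1)
    <= b * \sum_k `|dev (v, (s, k))|.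
  have -> : tv (local_law potts_weight v s) (fun=> q%:R^-1) =
      tv (normalize (fun k => expR (2 * b * neighbours v s k))) (fun=> q%:R^-1).
    by apply: eq_bigr => k _; rewrite local_law_potts.
  have := @tv_softmax_uniform_le R 'I_q (2 * b) (neighbours v s).
  rewrite card_ord sum_neighbours (_ : 2 * b / 2 = b); last by field.
  by apply; rewrite ?mulr_ge0.
have dist_le : \sum_v unif_dist potts_weight v <= b / M * \sum_x `|dev x|.
  rewrite (mulrAC b) -mulr_suml ler_wpM2r ?invr_ge0 //.
  rewrite -(pair_bigA _ (fun v p => `|dev (v, p)|)) /= mulr_sumr.
  apply: ler_sum => v _; rewrite -(pair_bigA _ (fun s k => `|dev (v, (s, k))|)) /=.
  by rewrite mulr_sumr ler_sum.
have sum_dev : \sum_x dev x ^+ 2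
    = (\sum_v (degree e v)%:R) * (M * ((q%:R - 1) / q%:R)).
  rewrite -(pair_bigA _ (fun v p => dev (v, p) ^+ 2)) /= mulr_suml.
  apply: eq_bigr => v _.
  rewrite -(pair_bigA _ (fun s k => dev (v, (s, k)) ^+ 2)) /= exchange_big /=.
  under eq_bigr do rewrite sum_sqr_neighbours.
  by rewrite sumr_const card_ord -mulr_natr -/M; field.
have q1 : q%:R - 1 = (q.-1)%:R :> R by rewrite -[in LHS](prednK q_gt0) -natr1 addrK.
apply: le_trans dist_le _.
apply: (@le_trans _ _ (b / M * Num.sqrt ((q.-1)%:R * (M ^+ 2 * N) * (2 * #|edges e|%:R)))).
  rewrite ler_wpM2l ?divr_ge0 ?(ltW M_gt0) //.
  apply: le_trans (sum_norm_le_sqrt _) _; rewrite ler_wsqrtr // sum_dev.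
  rewrite !card_prod card_ord !natrM -/M -/N q1.
  have -> : N * (M * q%:R) *
      ((\sum_v (degree e v)%:R) * (M * ((q.-1)%:R / q%:R))) =
      (q.-1)%:R * (M ^+ 2 * N) * (\sum_v (degree e v)%:R) by field.
  rewrite ler_wpM2l ?mulr_ge0 ?sqr_ge0 //.
  by rewrite -natr_sum -natrM ler_nat sum_degree_le.
have sqrtM2 : Num.sqrt (M ^+ 2) = M by rewrite sqrtr_sqr gtr0_norm.
move: (sqr_ge0 M) sqrtM2; move: (M ^+ 2) => M2 M2_ge0 sqrtM2.
have : 0 <= 2 * #|edges e|%:R :> R by rewrite mulr_ge0.
move: (2 * #|edges e|%:R) => E E_ge0.
rewrite !sqrtrM ?mulr_ge0 // sqrtM2 sqrtrV // /b -/N.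
(* For empty [V] both sides vanish, since [0^-1] and [Num.sqrt 0] are [0]. *)
have [N0|N0] := eqVneq N 0.
  by rewrite N0 invr0 mulr0 !mul0r sqrtr0 invr0 !mulr0.
have NN : Num.sqrt N ^+ 2 = N by rewrite sqr_sqrtr.
have sN : Num.sqrt N != 0 by rewrite sqrtr_eq0 -ltNge lt0r N0 /=.
rewrite le_eqVlt; apply/orP; left; apply/eqP.
rewrite -[X in beta / X]NN; field.
by rewrite sN gt_eqF.
Qed.

Lemma sum_influence u : \sum_v (e u v)%:R * tanh b <= (max_degree e)%:R * tanh b.
Proof.
rewrite -mulr_suml ler_wpM2r ?tanh_ge0 // -natr_sum ler_nat.
apply: leq_trans (leq_bigmax u); rewrite /degree -sum1dep_card.
by rewrite [leqRHS]big_mkcond; apply: leq_sum => v _; case: (e u v).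
Qed.

End Potts.

(** * Expectations and laws of random configurations *)

Section FiniteExpectation.
Context {R : realType} {d : measure_display} {T : measurableType d}.
Context {V : finType} {q : nat}.
Variables (P : probability T R) (X : T -> config V q).
Hypothesis rX : random_config X.

Lemma measurable_random_config (s : config V q) : measurable [set t | X t = s]%classic.
Proof.
have -> : ([set t | X t = s] = \bigcap_(v in [set: V]) [set t | X t v = s v])%classic.
  apply/seteqP; split=> t /= => [Xts v _|Xs]; first by rewrite -Xts.
  by apply/ffunP => v; exact: Xs.
by apply: fin_bigcap_measurable => // v _; exact: rX.
Qed.

(** [h \o X] is a finite combination of indicators of the events [X = s], so linearity computes the
    integral. *)
Lemma expectation_random_config (p : config V q -> R) (h : config V q -> R) :
    (forall s, P [set t | X t = s]%classic = (p s)%:E) ->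
  ('E_P[h \o X] = (\sum_s p s * h s)%:E)%E.
Proof.
move=> Xp; rewrite unlock.
under eq_integral => t _.
  rewrite (_ : (h \o X) t = \sum_s h s * \1_([set t | X t = s]%classic) t); last first.
    rewrite (bigD1 (X t)) //= indicE mem_set // mulr1 big1 ?addr0 // => s sX.
    by rewrite indicE memNset ?mulr0 //= => Xs; rewrite Xs eqxx in sX.
  rewrite -sumEFin; under eq_bigr do rewrite EFinM.
  over.
have int s : (P.-integrable setT
    (fun t => (h s)%:E * (\1_([set t | X t = s]%classic) t)%:E)%E).
  apply: integrableZl => //; apply: integrable_indic => //.
  exact: measurable_random_config.
rewrite integral_sum // -sumEFin; apply: eq_bigr => s _.
rewrite integralZl //; last exact/integrable_indic/measurable_random_config.
rewrite integral_indic ?setIT //; last exact: measurable_random_config.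
by rewrite [X in (_ * X)%E](Xp s) -EFinM mulrC.
Qed.

End FiniteExpectation.

(** Independence is applied to the set of all sites, giving a product of factors [1 / q]. *)
Lemma iid_uniform_law (R : realType) (d : measure_display) (T : measurableType d)
    (P : probability T R) (V : finType) (q : nat) (Y : T -> config V q) :
  iid_uniform P Y ->
  forall s, P [set t | Y t = s]%classic = (#|config V q|%:R^-1)%:E.
Proof.
move=> [_ indep unif] s.
have -> : ([set t | Y t = s]
    = [set t | forall v, v \in [set: V]%SET -> Y t v = s v])%classic.
  apply/seteqP; split=> t /= => [Yts v _|Ys]; first by rewrite -Yts.
  by apply/ffunP => v; apply: Ys; rewrite inE.
rewrite indep; under eq_bigr do rewrite unif.
rewrite prodEFin prodr_const cardsT card_ffun card_ord.
by rewrite natrX exprVn.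
Qed.

Theorem theorem1p2 (R : realType) (q : nat) (hq : (3 <= q)%N)
    (beta : R) (hbeta : 0 <= beta)
    (V : finType) (e : rel V) (e_sym : symmetric e) (e_irr : irreflexive e)
    (d d' : measure_display) (T : measurableType d) (T' : measurableType d')
    (P : probability T R) (P' : probability T' R)
    (X : T -> config V q) (hX : potts_distributed P e beta X)
    (Y : T' -> config V q) (hY : iid_uniform P' Y)
    (hD : (max_degree e)%:R * tanh (beta / #|V|%:R) < 1)
    (h : config V q -> R) :
  (`| 'E_P[h \o X] - 'E_P'[h \o Y] | <=
    (osc_norm h *
     (beta * Num.sqrt (q.-1)%:R
        / (1 - (max_degree e)%:R * tanh (beta / #|V|%:R))) *
     Num.sqrt (2 * #|edges e|%:R / #|V|%:R))%:E)%E.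
Proof.
have q_gt0 : (0 < q)%N by apply: leq_trans hq.
have [mX lawX] := hX; have [mY _ _] := hY.
rewrite (expectation_random_config mX h lawX).
rewrite (expectation_random_config mY h (iid_uniform_law hY)).
rewrite -EFinB abse_EFin lee_fin.
have -> : \sum_s potts e beta s * h s = gibbs_mean (potts_weight e beta) h.
  by rewrite /gibbs_mean mulr_suml; apply: eq_bigr => s _; rewrite mulrAC.
have -> : \sum_(s : config V q) #|config V q|%:R^-1 * h s = unif_mean h.
  by rewrite -mulr_sumr mulrC.
have w_gt0 (s : config V q) : 0 < potts_weight e beta s by exact: expR_gt0.
have hL := osc_norm_lipschitz h.
(* With no vertices the crude bound is [0], and so is the right-hand side, whose last square root
   has argument [x / 0 = 0]. *)
have [V0|V_gt0] := posnP #|V|.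
  apply: le_trans (gibbs_unif_dist_crude w_gt0 q_gt0 hL) _.
  by rewrite V0 invr0 !mulr0 sqrtr0 mul0r mulr0.
have L_ge0 := lipschitz_ge0 q_gt0 V_gt0 hL.
have b_ge0 : 0 <= beta / #|V|%:R by rewrite divr_ge0.
(* This influence matrix is supported on edges, so its row sums are at most
   [Delta * tanh (beta / N)], which [hD] keeps below [1]. *)
pose c u v : R := (e u v)%:R * tanh (beta / #|V|%:R).
have c_ge0 u v : 0 <= c u v by rewrite mulr_ge0 ?tanh_ge0.
have influence u v (s t : config V q) : u != v -> agree_off u s t ->
    tv (local_law (potts_weight e beta) v s)
       (local_law (potts_weight e beta) v t) <= c u v.
  by move=> _; exact: potts_influence.
have sum_c u : \sum_v c u v <= (max_degree e)%:R * tanh (beta / #|V|%:R).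
  exact: sum_influence.
apply: le_trans
  (gibbs_unif_dist w_gt0 q_gt0 V_gt0 influence c_ge0 sum_c hD hL) _.
rewrite [leLHS]mulrC -[leRHS]mulrA ler_wpM2l // [leRHS]mulrAC ler_wpM2r //.
  by rewrite invr_ge0 subr_ge0 ltW.
exact: sum_unif_dist_potts.
Qed.
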